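(* Let $\mathbf P=(P_1,\ldots,P_r)$ be a sequence of polytopes in $\mathbb{R}^d$ whose Minkowski sum is full-dimensional. For $t=\langle\mathbf 1,\mathbf x\rangle=x_1+\cdots+x_r$, one has the identity of rational functions in $\mathbf x=(x_1,\dots,x_r)$ and $\mathbf z=(z_1,\dots,z_d)$ $$m_{\mathbf P}(\mathbf x,\mathbf z)=\frac{\prod_{i=1}^r x_i}{\sum_{i=1}^r x_i}\cdot\mathrm{Vol}^\vee_{(\mathbf z,\mathbf x)}\bigl(t\,\mathcal C(\mathbf P)\bigr),$$ where the dual volume function on the right-hand side is calculated in the affine hyperplane $\{(\mathbf z,\mathbf x):\langle\mathbf 1,\mathbf x\rangle=t\}\subset\mathbb{R}^{d+r}$.
   Context: Support function: $h_Q(\mathbf v)=-\min_{\mathbf y\in Q}\langle\mathbf v,\mathbf y\rangle$. With $P=P_1+\cdots+P_r$, $\mathcal N(P)$ its normal fan (cones $\{\mathbf v:h_P(\mathbf v)=-\langle\mathbf v,\mathbf y\rangle\ \forall\mathbf y\in F\}$ for faces $F$), and any triangulation $\mathcal T$ of $\mathcal N(P)$ into full-dimensional simplicial cones generated by rays of $\mathcal N(P)$, the dual mixed volume function is $$m_{\mathbf P}(\mathbf x,\mathbf z)=\sum_{C=\mathrm{span}_{\ge0}(\mathbf v_1,\dots,\mathbf v_d)\in\mathcal T}\frac{|\det(\mathbf v_1,\dots,\mathbf v_d)|}{\prod_{j=1}^d\bigl(\sum_{i=1}^r x_ih_{P_i}(\mathbf v_j)+\langle\mathbf v_j,\mathbf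 z\rangle\bigr)}$$ (independent of $\mathcal T$ and of scaling of generators). The Cayley polytope is $\mathcal C(\mathbf P)=\mathrm{conv}\bigl(\bigcup_{i=1}^r P_i\times\{\mathbf e_i\}\bigr)\subset\mathbb{R}^{d+r}$, with $\mathbf e_i$ the standard basis of $\mathbb{R}^r$; it has dimension $d+r-1$ and lies in the hyperplane $\langle\mathbf u,\cdot\rangle=1$, where $\mathbf u=(0,\dots,0,1,\dots,1)\in\mathbb{R}^{d+r}$ ($d$ zeros, $r$ ones). The normal fan of $\mathcal C(\mathbf P)$ in $\mathbb{R}^{d+r}$ has lineality space $\mathbb{R}\mathbf u$; let $\mathcal N'$ be its image, a complete fan of pointed cones in $\mathbb{R}^{d+r}/\mathbb{R}\mathbf u$, and let $\mathcal T'$ be a triangulation of $\mathcal N'$ into simplicial cones of dimension $d+r-1$ generated by rays of $\mathcal N'$, with generators lifted arbitrarily to $\mathbb{R}^{d+r}$. The dual volume function in the hyperplane, normalized by the normal vector $\mathbf u$, is $$\mathrm{Vol}^\vee_{(\mathbf z,\mathbf x)}(t\,\mathcal C(\mathbf P))=\sum_{C=\mathrm{span}_{\geq 0}(\mathbf w_1,\dots,\mathbf w_{d+r-1})\in\mathcal T'}\frac{|\det(\mathbf w_1,\dots,\mathbf w_{d+r-1},\mathbf u)|}{\prod_{j=1}^{d+r-1}\bigl(t\,h_{\mathcal C(\mathbf P)}(\mathbf w_j)+\langle\mathbf w_j,(\mathbf z,\mathbf x)\rangle\bigr)},\qquad t=\langle\mathbf 1,\mathbf x\rangle,$$ which is independent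 of $\mathcal T'$, of the scaling of generators, and of the lifts (because $t=\langle\mathbf 1,\mathbf x\rangle$). *)

(* Defs.v *)
From HB Require Import structures.
From mathcomp Require Import all_boot all_order all_algebra.
From mathcomp Require Import classical_sets reals convex.
From mathcomp Require Import mpoly.

Set Implicit Arguments.
Unset Strict Implicit.
Unset Printing Implicit Defensive.

Import Order.TTheory GRing.Theory Num.Theory.

Local Open Scope classical_set_scope.
Local Open Scope ring_scope.

Section Polytopes.
Context {R : realType} {n : nat}.
Implicit Types (v w x y u : 'rV[R]_n) (Q F : set 'rV[R]_n) (s ls : seq 'rV[R]_n).

Definition dot v y : R := \sum_(k < n) v 0 k * y 0 k.

Definition conv_hull Q : set 'rV[R]_n :=
  smallest (@convex_set R 'rV[R]_n) Q.

Definition is_polytope Q : Prop :=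
  exists2 s, s != [::] & Q = conv_hull [set` s].

(* n + 1 affinely independent points in Q *)
Definition full_dimensional Q : Prop :=
  exists y0 s, [/\ Q y0, [set` s] `<=` Q &
    basis_of fullv [seq y - y0 | y <- s]].

(* For a polytope the infimum is attained, so it is the minimum. *)
Definition support Q v : R := - inf [set dot v y | y in Q].

(* Used both for polytopes and for cones; for a cone, the linear form is then
   nonnegative on it and the face is its zero locus in the cone.  The empty set
   is not a face. *)
Definition is_face Q F : Prop :=
  F !=set0 /\
  exists v, F = [set y | Q y /\ forall y', Q y' -> dot v y <= dot v y'].

Definition normal_cone Q F : set 'rV[R]_n :=
  [set v | forall y, F y -> support Q v = - dot v y].

Definition normal_fan Q : set (set 'rV[R]_n) :=
  [set normal_cone Q F | F in is_face Q].

(* A cone in the quotient by the linear span of ls is represented by its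
   preimage, a cone stable under translation by <<ls>>; faces, intersections and
   inclusions of cones correspond under taking preimages.  This is the preimage
   of the cone generated by the classes of the elements of s. *)
Definition cone_mod ls s : set 'rV[R]_n :=
  [set x | exists (c : nat -> R) (l : 'rV[R]_n),
    [/\ forall i, 0 <= c i, l \in <<ls>>%VS &
        x = \sum_(i < size s) c i *: s`_i + l]].

(* Triangulation, by full-dimensional simplicial cones generated by rays of N,
   of the fan whose cones are the images of those of N in the quotient by the
   linear span of ls.  A maximal cone is listed by (lifts of) its generators; a
   ray of N is a cone of N generated by one vector outside <<ls>>, which the first
   condition guarantees. *)
Definition is_triangulation ls (N : set (set 'rV[R]_n))
    (T : seq (seq 'rV[R]_n)) : Prop :=
  [/\ forall C, C \in T -> basis_of fullv (C ++ ls),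
      forall C v, C \in T -> v \in C -> N (cone_mod ls [:: v]),
      forall C, C \in T -> exists2 S, N S & cone_mod ls C `<=` S,
      forall S x, N S -> S x -> exists2 C, C \in T & cone_mod ls C x &
      forall i j, (i < size T)%N -> (j < size T)%N -> i != j ->
        let A := cone_mod ls (nth [::] T i) in
        let B := cone_mod ls (nth [::] T j) in
        [/\ A <> B, is_face A (A `&` B) & is_face B (A `&` B)]].

Definition det_seq s : R := \det (\matrix_(i < n, k < n) (s`_i) 0 k).

End Polytopes.

Section RationalFunctions.
Context (R : realType) (n : nat).

Definition ratfun : fieldType := {fraction {mpoly R[n]}}.

Definition rf_const (c : R) : ratfun := FracField.tofrac (c%:MP_[n]).

Definition rf_var (k : 'I_n) : ratfun :=
  FracField.tofrac 'X_k.

End RationalFunctions.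

Arguments rf_const {R} n c.
Arguments rf_var R {n} k.

Section DualVolumes.
Context {R : realType} {d r : nat}.

(* The d + r indeterminates are ordered as (z, x). *)
Definition zvar (k : 'I_d) : ratfun R (d + r) := rf_var R (lshift r k).
Definition xvar (i : 'I_r) : ratfun R (d + r) := rf_var R (rshift d i).

Local Notation K := (ratfun R (d + r)).
Local Notation const := (@rf_const R (d + r)).

Definition minkowski_sum (P : 'I_r -> set 'rV[R]_d) : set 'rV[R]_d :=
  [set y | exists2 f : 'I_r -> 'rV[R]_d,
    forall i, P i (f i) & y = \sum_(i < r) f i].

Definition cayley (P : 'I_r -> set 'rV[R]_d) : set 'rV[R]_(d + r) :=
  conv_hull (\bigcup_(i in [set: 'I_r])
    [set row_mx y (delta_mx 0 i) | y in P i]).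

Definition cayley_normal : 'rV[R]_(d + r) := row_mx 0 (const_mx 1).

Definition dual_mixed_volume (P : 'I_r -> set 'rV[R]_d)
    (T : seq (seq 'rV[R]_d)) : K :=
  \sum_(C <- T) const `|det_seq C| /
    \prod_(v <- C) (\sum_(i < r) xvar i * const (support (P i) v) +
                    \sum_(k < d) const (v 0 k) * zvar k).

(* Dual volume of t Q at (z, x), where Q and t Q lie in hyperplanes with normal
   vector u; T lists lifts of the generators of the cones. *)
Definition dual_volume_hyperplane (u : 'rV[R]_(d + r)) (t : K)
    (Q : set 'rV[R]_(d + r)) (T : seq (seq 'rV[R]_(d + r))) : K :=
  \sum_(C <- T) const `|det_seq (rcons C u)| /
    \prod_(w <- C) (t * const (support Q w) +
                    \sum_(k < d + r) const (w 0 k) * rf_var R k).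

End DualVolumes.

(* Main.v *)
Require Import Defs.
From HB Require Import structures.
From mathcomp Require Import all_boot all_order all_algebra.
From mathcomp Require Import perm ring lra.
From mathcomp Require Import boolp classical_sets reals interval_inference convex.
From mathcomp Require Import mpoly.

Set Implicit Arguments.
Unset Strict Implicit.
Unset Printing Implicit Defensive.

Import Order.TTheory GRing.Theory Num.Theory.

Local Open Scope classical_set_scope.
Local Open Scope ring_scope.

(** Modulo [cayley_normal], the points [(v, a)] are fibred over the [v] in the
    normal fan of the Minkowski sum, and the support function of the Cayley polytope
    is the maximum of the [h_i v - a_i].  Hence a triangulation [T] lifts to a second
    simplicial decomposition adapted to the Cayley polytope: the cones generated by
    the [(v_k, h v_k)], for a cone of [T], together with all standard vectors of the
    last [r] coordinates except the [j]-th.  The sum defining the dual volume, taken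
    over this decomposition, is [m_P * \sum_j \prod_(k != j) x_k^-1].  It remains to
    see that the sum does not depend on the decomposition, i.e. that
    [|det M| / \prod_j (M L)_j] is a valuation on simplicial cones.  This is shown by
    induction on the dimension, without integration: for a vector [xi] with
    [c = xi M^-1] one has [xi L = \sum_j c_j (M L)_j], which turns each term into a
    sum over facets, and the facets cancel within each hyperplane. *)

(** * Sums over fibres and small perturbations *)

Lemma sum_fibers_eq0 (V : nmodType) (I : finType) (T : eqType) (P : pred I)
    (key : I -> T) (F : I -> V) :
  (forall i0, P i0 -> \sum_(i | P i && (key i == key i0)) F i = 0) ->
  \sum_(i | P i) F i = 0.
Proof.
move=> h.
pose s := undup [seq key i | i <- enum P].
have -> : \sum_(i | P i) F i = \sum_(k <- s) \sum_(i | P i && (key i == k)) F i.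
  rewrite (exchange_big_dep P) /=; last by move=> k i _ /andP[].
  apply: eq_bigr => i Pi.
  rewrite (eq_bigl (fun k => k == key i)); last first.
    by move=> k; rewrite Pi eq_sym.
  rewrite -big_filter filter_pred1_uniq ?undup_uniq ?big_seq1 //.
  by rewrite mem_undup; apply: map_f; rewrite mem_enum.
rewrite big_seq big1 // => k; rewrite mem_undup => /mapP[i0].
by rewrite mem_enum => Pi0 ->; exact: h.
Qed.

Section Perturbation.
Variable R : realFieldType.
Implicit Types (a b e x : R).

(** Replaces limit arguments: one step size preserves the signs of finitely many nonzero values. *)
Lemma small_perturbation (s : seq (R * R)) :
  exists2 e, 0 < e & forall ab, ab \in s -> ab.1 != 0 -> `|e * ab.2| < `|ab.1|.
Proof.
elim: s => [|[a b] s [e e0 he]]; first by exists 1 => //; rewrite ltr01.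
have [->|a0] := eqVneq a 0.
  exists e => // ab; rewrite inE => /orP[/eqP -> /=|]; [by rewrite eqxx|exact: he].
have a'0 : 0 < `|a| by rewrite normr_gt0.
have b1 : 0 < `|b| + 1 by rewrite ltr_wpDl.
pose m := Num.min e (`|a| / (`|b| + 1)).
have m0 : 0 < m by rewrite lt_min e0 divr_gt0.
exists m => // ab; rewrite inE => /orP[/eqP -> /= _|abs ab0].
  rewrite normrM (gtr0_norm m0).
  apply: (@le_lt_trans _ _ ((`|a| / (`|b| + 1)) * `|b|)).
    by rewrite ler_wpM2r // ge_min lexx orbT.
  by rewrite mulrAC ltr_pdivrMr // ltr_pM2l // ltrDl ltr01.
apply: le_lt_trans (he _ abs ab0).
by rewrite !normrM ler_wpM2r // !gtr0_norm // ge_min lexx.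
Qed.

Lemma addr_small_ge0 a x : `|x| < `|a| -> (0 <= a + x) = (0 <= a).
Proof.
by case: (ger0P a) => ha; rewrite ltr_norml => /andP[h1 h2]; apply/idP/idP; lra.
Qed.

Lemma addr_small_neq0 a x : `|x| < `|a| -> a + x != 0.
Proof.
by move=> h; apply/eqP => /eqP; rewrite addr_eq0 => /eqP e; rewrite e normrN ltxx in h.
Qed.

End Perturbation.

(** * Facets of simplicial cones *)

Definition in_cone (R : realFieldType) n (M : 'M[R]_n) (p : 'rV[R]_n) :=
  [forall j, 0 <= (p *m invmx M) 0 j].

Section Facets.
Variables (R : realFieldType) (n : nat).
Implicit Types (M : 'M[R]_n.+1) (p : 'rV[R]_n.+1).

(** Inner normal of the facet opposite to row [j], scaled so that pairing it with [p] gives the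
    [j]-th coordinate of [p] in the rows of [M]. *)
Definition facet_normal M (j : 'I_n.+1) : 'cV[R]_n.+1 := col j (invmx M).

Lemma mulmx_facet_normal M j i : M \in unitmx ->
  (M *m facet_normal M j) i 0 = (i == j)%:R.
Proof.
move=> uM; by rewrite /facet_normal colE mulmxA mulmxV // mul1mx mxE eqxx andbT.
Qed.

Lemma facet_coord p M j : (p *m facet_normal M j) 0 0 = (p *m invmx M) 0 j.
Proof. by rewrite /facet_normal colE mulmxA -colE [LHS]mxE. Qed.

End Facets.

Section FacetRelation.
Variables (R : realFieldType) (n : nat) (M0 : 'M[R]_n.+1) (j0 : 'I_n.+1).
Hypothesis uM0 : M0 \in unitmx.

Let B := row' j0 M0.
Let eta := row j0 M0.
Let g := facet_normal M0 j0.

(** Both sides take the same value on each row of the invertible [M0]: they vanish on the rows of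
    [B], and [g] is 1 on [eta]. *)
Lemma hyperplane_eq0 (h : 'cV[R]_n.+1) :
  B *m h = 0 -> h = (eta *m h) 0 0 *: g.
Proof.
move=> Bh; apply: (can_inj (mulKmx uM0)).
apply/matrixP => i k; rewrite (ord1 k) -scalemxAr [RHS]mxE mulmx_facet_normal //.
case: (unliftP j0 i) => [i' ->|->].
  have := congr1 (fun A : 'cV__ => A i' 0) Bh.
  rewrite eq_sym (negPf (neq_lift _ _)) mulr0 [RHS]mxE => <-; rewrite !mxE.
  by apply: eq_bigr => l _; rewrite !mxE.
rewrite eqxx mulr1 !mxE; apply: eq_bigr => l _; by rewrite !mxE.
Qed.

Section OneFacet.
Variables (M : 'M[R]_n.+1) (j : 'I_n.+1).
Hypotheses (uM : M \in unitmx) (Bg : B *m facet_normal M j = 0).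

Let lam := (eta *m facet_normal M j) 0 0.

(** The rows of [M] other than row [j], in the basis [B] of the hyperplane. The rows of
    [M *m invmx M0] are coordinates in the rows of [M0]; since the facet lies in the hyperplane,
    dropping column [j0] loses nothing. *)
Definition facet_mx : 'M[R]_n := row' j (col' j0 (M *m invmx M0)).

Lemma facet_normalE : facet_normal M j = lam *: g.
Proof. exact: hyperplane_eq0. Qed.

Lemma facet_scale_neq0 : lam != 0.
Proof.
apply/eqP => l0; have := mulmx_facet_normal j j uM.
by rewrite facet_normalE l0 scale0r mulmx0 mxE eqxx => /eqP; rewrite eq_sym oner_eq0.
Qed.

Lemma facet_colE k : (M *m invmx M0) k j0 = (k == j)%:R / lam.
Proof.
have := mulmx_facet_normal j k uM; rewrite facet_normalE -scalemxAr mxE.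
move=> <-; rewrite mulrAC mulfV ?facet_scale_neq0 // mul1r.
by rewrite /g /facet_normal colE mulmxA -colE [RHS]mxE.
Qed.

Lemma facet_mx_row : facet_mx *m B = row' j M.
Proof.
rewrite -[M in RHS](mulmxKV uM0); apply/matrixP => i k.
rewrite [LHS]mxE [RHS]mxE [RHS]mxE (bigD1_ord j0) //= facet_colE.
rewrite eq_sym (negPf (neq_lift _ _)) mul0r mul0r add0r.
by apply: eq_bigr => l _; rewrite !mxE.
Qed.

(** Expansion of [\det (M *m invmx M0)] along column [j0], whose only nonzero entry is [lam^-1], in
    row [j]. The sign of [lam] tells whether the cone of [M] lies on the side of [eta]. *)
Lemma facet_mx_det : lam * `|\det M| = Num.sg lam * `|\det M0| * `|\det facet_mx|.
Proof.
have e : \det M = \det (M *m invmx M0) * \det M0.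
  by rewrite -det_mulmx mulmxKV.
rewrite e (expand_det_col _ j0) (bigD1 j) //= big1 ?addr0; last first.
  by move=> i /negPf ij; rewrite facet_colE ij mul0r mul0r.
rewrite facet_colE eqxx mul1r /cofactor !normrM normfV normrX normrN normr1 expr1n mul1r.
rewrite -/facet_mx {1}[lam]numEsg.
have : `|lam| != 0 by rewrite normr_eq0 facet_scale_neq0.
move: (`|lam|) => l l0; field; exact: l0.
Qed.

Lemma facet_mx_unit : facet_mx \in unitmx.
Proof.
rewrite unitmxE unitfE; apply/eqP => d0.
have := facet_mx_det; rewrite d0 normr0 mulr0 => /eqP.
rewrite mulf_eq0 (negPf facet_scale_neq0) normr_eq0 /=.
by move: uM; rewrite unitmxE unitfE => /negPf ->.
Qed.

Lemma facet_mx_coord (q : 'rV[R]_n) k :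
  (q *m B *m invmx M) 0 (lift j k) = (q *m invmx facet_mx) 0 k.
Proof.
rewrite -[q in LHS](mulmxKV facet_mx_unit) -(mulmxA _ facet_mx) facet_mx_row.
set q' := q *m _; rewrite -mulmxA.
have -> : row' j M *m invmx M = row' j 1%:M.
  by rewrite -[in RHS](mulmxV uM); apply/matrixP => a b; rewrite !mxE; apply: eq_bigr => l _; rewrite !mxE.
rewrite mxE (bigD1 k) //= big1 ?addr0; first by rewrite !mxE eqxx mulr1.
by move=> i ik; rewrite !mxE (inj_eq lift_inj) (negPf ik) mulr0.
Qed.

End OneFacet.
End FacetRelation.

(** * Relations between cones, restricted to a hyperplane *)

Section FacetSum.
Variables (R : realFieldType) (n : nat) (I : finType) (P : pred I).
Variables (a : I -> R) (M : I -> 'M[R]_n.+1) (G : seq 'cV[R]_n.+1).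
Hypothesis uM : forall i, P i -> M i \in unitmx.
Hypothesis nG : forall g, g \in G -> g != 0.
Hypothesis rel : forall p, (forall g, g \in G -> (p *m g) 0 0 != 0) ->
  \sum_(i | P i && in_cone (M i) p) a i = 0.
Variables (i0 : I) (j0 : 'I_n.+1).
Hypothesis Pi0 : P i0.

Let B := row' j0 (M i0).
Let eta := row j0 (M i0).
Let E (x : I * 'I_n.+1) := B *m facet_normal (M x.1) x.2 == 0.
Let lam (x : I * 'I_n.+1) := (eta *m facet_normal (M x.1) x.2) 0 0.
Let N (x : I * 'I_n.+1) := facet_mx (M i0) j0 (M x.1) x.2.

(** Genericity conditions on a point [q] of the hyperplane: the restrictions of [G] and of all facet
    normals. Zero restrictions are dropped, as no [q] could satisfy them. *)
Definition facet_functionals : seq 'cV[R]_n :=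
  [seq h <- [seq B *m g | g <- G] ++
    [seq B *m facet_normal (M x.1) x.2 | x : I * 'I_n.+1] | h != 0].

(** Subtract the relations at two points on either side of [q *m B]. A cone without a facet in the
    hyperplane contains both or neither; a cone with a facet there that contains [q] contains
    exactly one of them, selected by the sign of [lam]. *)
Lemma facet_relation q :
  (forall h, h \in facet_functionals -> (q *m h) 0 0 != 0) ->
  \sum_(x | (P x.1 && E x) && in_cone (N x) q) a x.1 * Num.sg (lam x) = 0.
Proof.
move=> gq; pose p := q *m B.
pose F := G ++ [seq facet_normal (M x.1) x.2 | x : I * 'I_n.+1].
have [e e0 he] := small_perturbation [seq ((p *m g) 0 0, (eta *m g) 0 0) | g <- F].
have pF g : g \in F -> B *m g != 0 -> (p *m g) 0 0 != 0.
  move=> gF Bg; rewrite /p -mulmxA; apply: gq; rewrite mem_filter Bg mem_cat /=.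
  move: gF; rewrite mem_cat => /orP[/(map_f (fun g => B *m g)) -> //|].
  by case/fintype.imageP => x _ eg; apply/orP; right; apply/fintype.imageP; exists x => //; rewrite eg.
have p0 g : B *m g = 0 -> (p *m g) 0 0 = 0.
  by move=> Bg; rewrite /p -mulmxA Bg mulmx0 mxE.
(* The values 1 and -1 of [s] give the two sides of the hyperplane. *)
pose pt (s : R) := p + (s * e) *: eta.
have ptE s (g : 'cV[R]_n.+1) : (pt s *m g) 0 0 = (p *m g) 0 0 + s * (e * (eta *m g) 0 0).
  by rewrite mulmxDl mxE -scalemxAl [in X in _ + X]mxE mulrA.
have small s g : `|s| = 1 -> g \in F -> (p *m g) 0 0 != 0 ->
    `|s * (e * (eta *m g) 0 0)| < `|(p *m g) 0 0|.
  move=> s1 gF pg; rewrite normrM s1 mul1r.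
  exact: (he ((p *m g) 0 0, (eta *m g) 0 0) (map_f _ gF) pg).
have gF i j : facet_normal (M i) j \in F.
  by rewrite mem_cat; apply/orP; right; apply/fintype.imageP; exists (i, j).
have relpt s : `|s| = 1 -> \sum_(i | P i && in_cone (M i) (pt s)) a i = 0.
  move=> s1; apply: rel => g gG; rewrite ptE.
  have gF' : g \in F by rewrite mem_cat gG.
  have [Bg|Bg] := eqVneq (B *m g) 0; last by apply/addr_small_neq0/small/pF.
  (* A member of [G] vanishing on the hyperplane is a nonzero multiple of its normal, hence nonzero
     on [eta]. *)
  rewrite p0 // add0r !mulf_neq0 ?(gt_eqF e0) //.
    by rewrite -normr_eq0 s1 oner_eq0.
  apply: contraNneq (nG gG) => eg.
  by rewrite (hyperplane_eq0 (uM Pi0) Bg) eg scale0r.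
have same s i j : `|s| = 1 -> ~~ E (i, j) ->
    (0 <= (pt s *m invmx (M i)) 0 j) = (0 <= (p *m invmx (M i)) 0 j).
  move=> s1 Eij; rewrite -!facet_coord ptE addr_small_ge0 //.
  by apply: small => //; exact: pF.
transitivity (\sum_(i | P i) (a i * (in_cone (M i) (pt 1))%:R -
                              a i * (in_cone (M i) (pt (-1)))%:R)); last first.
  have conv s : \sum_(i | P i) a i * (in_cone (M i) (pt s))%:R =
      \sum_(i | P i && in_cone (M i) (pt s)) a i.
    rewrite [RHS]big_mkcondr; apply: eq_bigr => i _.
    by case: in_cone; rewrite ?mulr1 ?mulr0.
  by rewrite sumrB !conv !relpt ?normrN ?normr1 // subr0.
rewrite -(eq_bigl _ _ (fun x => andbA (P x.1) (E x) (in_cone (N x) q))).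
rewrite -(pair_big_dep P (fun i j => E (i, j) && in_cone (N (i, j)) q)
   (fun i j => a i * Num.sg (lam (i, j)))) /=.
apply: eq_bigr => i Pi; rewrite -mulrBr -mulr_sumr; congr (_ * _).
have [/existsP[j Ej]|/existsPn noE] := boolP [exists j, E (i, j)]; last first.
  rewrite big_pred0; last by move=> j; rewrite (negPf (noE j)).
  suff h s : `|s| = 1 -> in_cone (M i) (pt s) = in_cone (M i) p.
    by rewrite !h ?normrN ?normr1 // subrr.
  by move=> s1; apply: eq_forallb => j; rewrite same.
(* Two facets of one cone in the hyperplane would have proportional normals, although [M i] is
   invertible. *)
have Ek k : E (i, k) = (k == j).
  apply/idP/eqP => [Ek|-> //]; apply/eqP; apply: contraT => kj.
  have := mulmx_facet_normal k j (uM Pi); have := mulmx_facet_normal j j (uM Pi).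
  rewrite (facet_normalE (uM Pi0) (eqP Ek)) (facet_normalE (uM Pi0) (eqP Ej)).
  rewrite -!scalemxAr ![fun_of_matrix (_ *: _) _ _]mxE eqxx [j == k]eq_sym (negPf kj) => h1 /eqP.
  rewrite mulf_eq0 (negPf (facet_scale_neq0 (uM Pi0) (uM Pi) (eqP Ek))) /=.
  by move=> /eqP h2; move: h1; rewrite h2 mulr0 => /eqP; rewrite eq_sym oner_eq0.
have lam0 : lam (i, j) != 0 by exact: (facet_scale_neq0 (uM Pi0) (uM Pi) (eqP Ej)).
have coneE s : `|s| = 1 ->
    in_cone (M i) (pt s) = (0 <= s * lam (i, j)) && in_cone (N (i, j)) q.
  move=> s1.
  have ptj : (0 <= (pt s *m invmx (M i)) 0 j) = (0 <= s * lam (i, j)).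
    by rewrite -facet_coord ptE p0 ?(eqP Ej) // add0r mulrCA pmulr_rge0.
  have ptk k : (0 <= (pt s *m invmx (M i)) 0 (lift j k)) =
               (0 <= (q *m invmx (N (i, j))) 0 k).
    rewrite same //; last by rewrite Ek eq_sym neq_lift.
    by rewrite (facet_mx_coord (uM Pi0) (uM Pi) (eqP Ej)).
  apply/forallP/andP => [h|[h1 /forallP h2] k].
    by split; [rewrite -ptj|apply/forallP => k; rewrite -ptk].
  by case: (unliftP j k) => [k' ->|->]; rewrite ?ptk ?ptj.
rewrite !coneE ?normrN ?normr1 // mul1r mulN1r oppr_ge0.
rewrite (eq_bigl (fun k => (k == j) && in_cone (N (i, j)) q)); last first.
  by move=> k; rewrite Ek; case: eqP => // ->.
rewrite big_mkcondr big_pred1_eq; case: in_cone; rewrite ?andbT ?andbF ?subrr //.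
by have [l|l|l] := sgrP (lam (i, j)); rewrite ?l ?eqxx // ?subr0 ?sub0r // in lam0 *.
Qed.

End FacetSum.

(** * The valuation property *)

Lemma cone_valuation (R : realFieldType) (K : fieldType) (f : {rmorphism R -> K})
    n (I : finType) (P : pred I) (a : I -> R) (M : I -> 'M[R]_n) (L : 'cV[K]_n)
    (G : seq 'cV[R]_n) :
  (forall i, P i -> M i \in unitmx) ->
  (forall i j, P i -> (map_mx f (M i) *m L) j 0 != 0) ->
  (forall g, g \in G -> g != 0) ->
  (forall p, (forall g, g \in G -> (p *m g) 0 0 != 0) ->
    \sum_(i | P i && in_cone (M i) p) a i = 0) ->
  \sum_(i | P i) f (a i * `|\det (M i)|) / \prod_j (map_mx f (M i) *m L) j 0 = 0.
Proof.
elim: n I P a M L G => [|n IH] I P a M L G uM nL nG rel.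
  (* In dimension 0 every cone contains the only point, and the relation there is the claim. *)
  rewrite -[RHS](rmorph0 f) -(rel 0); last first.
    by move=> g gG; have := nG g gG; rewrite (flatmx0 g) eqxx.
  rewrite rmorph_sum; apply: eq_big => [i|i Pi].
    by case: (P i) => //=; symmetry; apply/forallP; case.
  by rewrite big_ord0 det_mx00 normr1 mulr1 divr1.
have [/existsP[i0 Pi0]|/existsPn noP] := boolP [exists i, P i]; last first.
  by rewrite big_pred0 // => i; apply/negbTE/noP.
(* Taking a generator of one of the cones as [xi] makes [xiL] nonzero by hypothesis. *)
pose xi := row 0 (M i0); pose xiL := (map_mx f xi *m L) 0 0.
have xiL0 : xiL != 0.
  rewrite /xiL; have := nL i0 0 Pi0.
  by rewrite /xi map_row -row_mul [X in _ -> X != 0]mxE.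
pose c i j := (xi *m facet_normal (M i) j) 0 0.
pose term x := f (a x.1 * `|\det (M x.1)| * c x.1 x.2) /
  \prod_k (map_mx f (M x.1) *m L) (lift x.2 k) 0.
have expand i : P i -> xiL * (f (a i * `|\det (M i)|) /
    \prod_j (map_mx f (M i) *m L) j 0) = \sum_j term (i, j).
  move=> Pi.
  have -> : xiL = \sum_j f (c i j) * (map_mx f (M i) *m L) j 0.
    rewrite /xiL -[xi](mulmxKV (uM i Pi)) map_mxM -mulmxA mxE.
    by apply: eq_bigr => j _; rewrite mxE /c facet_coord.
  rewrite mulr_suml; apply: eq_bigr => j _.
  rewrite /term [in LHS](bigD1_ord j) //= [in RHS]rmorphM /=.
  have := nL i j Pi; move: ((_ *m L) j 0) => m m0.
  have : \prod_k (map_mx f (M i) *m L) (lift j k) 0 != 0.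
    by apply/prodf_neq0 => k _; exact: nL.
  move: (\prod_k _) => m' m'0; field; by rewrite m0 m'0.
apply: (mulfI xiL0); rewrite mulr0 mulr_sumr (eq_bigr _ expand).
rewrite pair_big_dep /=.
(* Facets are grouped by the line spanned by their normal, encoded by a canonical matrix. *)
apply: (@sum_fibers_eq0 _ _ _ _ (fun x => <<(facet_normal (M x.1) x.2)^T>>%MS)).
case=> i1 j1 /= /andP[Pi1 _].
pose B := row' j1 (M i1); pose eta := row j1 (M i1).
pose E (x : I * 'I_n.+1) := B *m facet_normal (M x.1) x.2 == 0.
pose lam (x : I * 'I_n.+1) := (eta *m facet_normal (M x.1) x.2) 0 0.
pose N (x : I * 'I_n.+1) := facet_mx (M i1) j1 (M x.1) x.2.
have keyE x : P x.1 ->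
  (<<(facet_normal (M x.1) x.2)^T>>%MS == <<(facet_normal (M i1) j1)^T>>%MS) = E x.
  move=> Px; apply/eqP/eqP => [/genmxP/andP[/sub_rVP[l el] _]|Ex].
    have -> : facet_normal (M x.1) x.2 = l *: facet_normal (M i1) j1.
      by apply: trmx_inj; rewrite el linearZ.
    rewrite -scalemxAr; apply/matrixP => k z; rewrite (ord1 z) mxE.
    have := mulmx_facet_normal j1 (lift j1 k) (uM i1 Pi1).
    rewrite eq_sym (negPf (neq_lift _ _)) !mxE => e.
    rewrite (eq_bigr (fun l => M i1 (lift j1 k) l * facet_normal (M i1) j1 l 0)).
      by rewrite e mulr0.
    by move=> y _; rewrite mxE.
  rewrite (facet_normalE (uM _ Pi1) Ex) linearZ /=.
  exact/eq_genmx/eqmx_scale/(facet_scale_neq0 (uM _ Pi1) (uM _ Px) Ex).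
pose L' := map_mx f B *m L.
have NL x k : P x.1 -> E x -> (map_mx f (N x) *m L') k 0 =
    (map_mx f (M x.1) *m L) (lift x.2 k) 0.
  move=> Px Ex; rewrite mulmxA -map_mxM (facet_mx_row (uM _ Pi1) (uM _ Px) (eqP Ex)).
  by rewrite !mxE; apply: eq_bigr => y _; rewrite !mxE.
(* The factor shared by the group: [facet_mx_det] leaves in each term only the sign of [lam] and the
   determinant of the facet, besides data of the reference facet [(i1, j1)]. *)
pose C := f ((xi *m facet_normal (M i1) j1) 0 0 * `|\det (M i1)|).
transitivity (\sum_(x | P x.1 && E x) C * (f (a x.1 * Num.sg (lam x) * `|\det (N x)|) /
    \prod_k (map_mx f (N x) *m L') k 0)).
  apply: eq_big => x; first by rewrite andbT; case Px : (P x.1); rewrite //= keyE.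
  case/andP => /andP[Px _]; rewrite keyE // => Ex.
  rewrite /term /c (eq_bigr _ (fun k _ => NL x k Px Ex)).
  rewrite mulrA -rmorphM /=; congr (f _ / _).
  rewrite [in LHS](facet_normalE (uM _ Pi1) (eqP Ex)) -scalemxAr [fun_of_matrix (_ *: _) _ _]mxE.
  rewrite -[_ * `|_| * _]mulrA (mulrA `|_|) (mulrC `|_|).
  by rewrite (facet_mx_det (uM _ Pi1) (uM _ Px) (eqP Ex)) -/(lam x) -/(N x); ring.
rewrite -mulr_sumr (IH _ _ _ _ _ (facet_functionals M G i1 j1)) ?mulr0 //.
- move=> x /andP[Px Ex]; exact: (facet_mx_unit (uM _ Pi1) (uM _ Px) (eqP Ex)).
- by move=> x k /andP[Px Ex]; rewrite NL //; exact: nL.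
- by move=> h; rewrite mem_filter => /andP[].
- exact: (facet_relation uM nG rel).
Qed.

Lemma row_in_cone (R : realFieldType) n (M : 'M[R]_n) j :
  M \in unitmx -> in_cone M (row j M).
Proof.
by move=> uM; apply/forallP => k; rewrite -row_mul mulmxV // !mxE ler0n.
Qed.

(** Cones are grouped by the linear form [L] representing [phi] on them. Two cones sharing a generic
    point share a neighbourhood of it, hence have the same [L]; so the relation holds within each
    group and [cone_valuation] applies. *)
Lemma piecewise_valuation (R : realFieldType) (K : fieldType)
    (f : {rmorphism R -> K}) n (I : finType) (a : I -> R) (M : I -> 'M[R]_n)
    (phi : 'rV[R]_n -> K) :
  (forall i, M i \in unitmx) ->
  (forall i j, phi (row j (M i)) != 0) ->
  (forall i, exists L : 'cV[K]_n,
    forall p, in_cone (M i) p -> phi p = (map_mx f p *m L) 0 0) ->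
  (forall p, (forall i j, (p *m invmx (M i)) 0 j != 0) ->
    \sum_(i | in_cone (M i) p) a i = 0) ->
  \sum_i f (a i * `|\det (M i)|) / \prod_j phi (row j (M i)) = 0.
Proof.
move=> uM nphi /fin_all_exists[L hL] rel.
pose G := [seq col x.2 (invmx (M x.1)) | x : I * 'I_n].
have coordE p i j : (p *m col j (invmx (M i))) 0 0 = (p *m invmx (M i)) 0 j.
  by rewrite colE mulmxA -colE [LHS]mxE.
have phiE i j : phi (row j (M i)) = (map_mx f (M i) *m L i) j 0.
  by rewrite (hL i _ (row_in_cone j (uM i))) map_row -row_mul mxE.
have overlap p i j : (forall i j, (p *m invmx (M i)) 0 j != 0) ->
    in_cone (M i) p -> in_cone (M j) p -> L i = L j.
  move=> gp pi pj; apply/colP => k.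
  pose ek : 'rV[R]_n := delta_mx 0 k.
  have [e e0 he] := small_perturbation [seq ((p *m invmx (M x.1)) 0 x.2,
    (ek *m invmx (M x.1)) 0 x.2) | x : I * 'I_n].
  have inpe i' : in_cone (M i') p -> in_cone (M i') (p + e *: ek).
    move=> /forallP h; apply/forallP => l.
    rewrite mulmxDl -scalemxAl mxE [X in _ + X]mxE addr_small_ge0 //.
    apply: (he ((p *m invmx (M i')) 0 l, (ek *m invmx (M i')) 0 l)); last exact: gp.
    by apply/fintype.imageP; exists (i', l).
  (* The increment of [phi] along [ek] determines the [k]-th entry of [L i']. *)
  have Lk i' : in_cone (M i') p -> f e * L i' k 0 = phi (p + e *: ek) - phi p.
    move=> pi'; rewrite (hL i' _ pi') (hL i' _ (inpe _ pi')) map_mxD map_mxZ mulmxDl -scalemxAl.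
    rewrite [fun_of_matrix (_ + _) _ _]mxE [fun_of_matrix (_ *: _) _ _]mxE.
    by rewrite map_delta_mx -rowE [fun_of_matrix (row _ _) _ _]mxE addrAC subrr add0r.
  have fe0 : f e != 0 by rewrite fmorph_eq0 gt_eqF.
  by apply: (mulfI fe0); rewrite !Lk.
apply: (@sum_fibers_eq0 _ _ _ _ L) => i0 _.
rewrite -[RHS](@cone_valuation _ _ f _ _ (fun i => L i == L i0) a M (L i0) G) //.
- by apply: eq_bigr => i /andP[_ /eqP e]; rewrite (eq_bigr _ (fun j _ => phiE i j)) e.
- by move=> i j /eqP e; rewrite -e -phiE.
- move=> g /fintype.imageP[[i j] _ ->] /=; apply/eqP => h.
  have /eqP := congr1 (fun A => (row j (M i) *m A) 0 0) h.
  rewrite coordE mulmx0 -row_mul mulmxV // !mxE eqxx => /eqP.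
  by move/eqP; rewrite oner_eq0.
- move=> p gp.
  have {}gp i j : (p *m invmx (M i)) 0 j != 0.
    by rewrite -coordE; apply: gp; apply/fintype.imageP; exists (i, j).
  (* Either no cone of the group contains [p], or all cones containing [p] belong to the group. *)
  have [/existsP[i /andP[/eqP Li pi]]|/existsPn no] :=
    boolP [exists i, (L i == L i0) && in_cone (M i) p]; last first.
    by rewrite big_pred0 // => i; apply/negbTE/no.
  rewrite -[RHS](rel p gp); apply: eq_bigl => j.
  case pj : (in_cone (M j) p); rewrite ?andbF ?andbT //.
  by rewrite -Li (overlap p j i) // eqxx.
Qed.

(** * Cones modulo a line *)

Section QuotientCones.
Context {R : realType}.

Definition seq_mx n (s : seq 'rV[R]_n) : 'M[R]_n := \matrix_(i, k) s`_i 0 k.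

Lemma row_seq_mx n (s : seq 'rV[R]_n) i : row i (seq_mx s) = s`_i.
Proof. by apply/rowP => k; rewrite !mxE. Qed.

Lemma mul_seq_mx n (q : 'rV[R]_n) (s : seq 'rV[R]_n) :
  q *m seq_mx s = \sum_i q 0 i *: s`_i.
Proof. by rewrite mulmx_sum_row; apply: eq_bigr => i _; rewrite row_seq_mx. Qed.

(** The interior of [cone_mod ls s] when [s] and [ls] together form a basis. *)
Definition cone_mod_int n (ls s : seq 'rV[R]_n) : set 'rV[R]_n :=
  [set x | exists (c : nat -> R) (l : 'rV[R]_n),
    [/\ forall i, 0 < c i, l \in <<ls>>%VS &
        x = \sum_(i < size s) c i *: s`_i + l]].

Section Lifts.
Variables (m : nat) (u : 'rV[R]_m.+1) (k0 : 'I_m.+1) (C : seq 'rV[R]_m.+1).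
Hypotheses (u1 : u 0 k0 = 1) (sC : size C = m).
Hypothesis dC : det_seq (rcons C u) != 0.

Definition normal_lift (w : 'rV[R]_m.+1) := w - w 0 k0 *: u.

Definition lift_mx := seq_mx (rcons (map normal_lift C) u).

Lemma mul_lift_mx (q : 'rV[R]_m.+1) : q *m lift_mx =
  \sum_(i < size C) q 0 (inord i) *: C`_i +
  (q 0 ord_max - \sum_(i < size C) q 0 (inord i) * C`_i 0 k0) *: u.
Proof.
rewrite mul_seq_mx big_ord_recr /= nth_rcons size_map sC ltnn eqxx.
rewrite scalerBl scaler_suml [RHS]addrCA [RHS]addrC -sumrB; congr (_ + _).
apply: eq_bigr => i _; rewrite nth_rcons size_map sC ltn_ord.
rewrite (nth_map 0) ?sC // /normal_lift scalerBr scalerA.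
have -> // : widen_ord (leqnSn m) i = inord i.
by apply: val_inj; rewrite /= inordK // ltnW // ltnS.
Qed.

Lemma mul_lift_mx_k0 (q : 'rV[R]_m.+1) : (q *m lift_mx) 0 k0 = q 0 ord_max.
Proof.
rewrite mul_lift_mx !mxE summxE u1 mulr1.
rewrite (eq_bigr (fun i : 'I_(size C) => q 0 (inord i) * C`_i 0 k0)).
  by rewrite addrC subrK.
by move=> i _; rewrite mxE.
Qed.

(** Lifting subtracts multiples of the last row [u] from the others, a unitriangular row
    operation. *)
Lemma det_lift_mx : \det lift_mx = det_seq (rcons C u).
Proof.
pose F : 'M[R]_m.+1 := \matrix_(x, y)
  if (x < m)%N && (y == ord_max) then C`_x 0 k0 else 0.
have -> : lift_mx = (1%:M - F) *m seq_mx (rcons C u).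
  apply/row_matrixP => x; rewrite mulmxBl mul1mx linearB /= row_mul !row_seq_mx.
  rewrite mul_seq_mx (bigD1 ord_max) //= big1 ?addr0 => [|y /negPf ym]; last first.
    by rewrite !mxE ym andbF scale0r.
  rewrite !mxE eqxx andbT !nth_rcons size_map sC ltnn eqxx.
  case: ifP => xm; last by rewrite scale0r subr0.
  by rewrite (nth_map 0) ?sC.
rewrite det_mulmx -[\det (1%:M - F)]det_tr det_trig ?big1 ?mul1r //.
  by move=> x _; rewrite !mxE eqxx; case: eqP => [->|]; rewrite /= ?ltnn ?andbF ?subr0.
apply/is_trig_mxP => x y xy; rewrite !mxE.
have -> : (y == x) = false by rewrite -val_eqE /= gtn_eqF.
have -> : (x == ord_max) = false.
  by rewrite -val_eqE /= ltn_eqF // (leq_trans xy) // -ltnS.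
by rewrite andbF subrr.
Qed.

Lemma lift_mx_unit : lift_mx \in unitmx.
Proof. by rewrite unitmxE unitfE det_lift_mx. Qed.

(** The lifts have [k0]-th coordinate 0 and [u] has 1, so this coordinate of [p] is the coefficient
    of [u]. *)
Lemma in_cone_lift p :
  in_cone lift_mx p <-> 0 <= p 0 k0 /\ cone_mod [:: u] C p.
Proof.
split=> [/forallP h|[p0 [c [l [c0 /[!span_seq1]/vlineP[b ->] pE]]]]].
  rewrite -[p](mulmxKV lift_mx_unit) mul_lift_mx_k0; split; first exact: h.
  rewrite mul_lift_mx; set q := p *m _.
  exists (fun i => q 0 (inord i)),
    ((q 0 ord_max - \sum_(i < size C) q 0 (inord i) * C`_i 0 k0) *: u).
  by split=> //; rewrite span_seq1 memvZ ?memv_line.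
(* The coefficient [b] of [u] belongs to the given generators; for their lifts it becomes
   [p 0 k0]. *)
pose q : 'rV[R]_m.+1 := \row_x (if (x < m)%N then c x else p 0 k0).
have qi i : (i < m)%N -> q 0 (inord i) = c i.
  by move=> im; rewrite mxE inordK ?im // ltnW // ltnS.
have iC (i : 'I_(size C)) : (i < m)%N by have := ltn_ord i; rewrite [X in (_ < X)%N]sC.
suff -> : p = q *m lift_mx.
  rewrite /in_cone mulmxK ?lift_mx_unit //; apply/forallP => x; rewrite mxE.
  by case: ifP.
rewrite mul_lift_mx {1}pE; congr (_ + _).
  by apply: eq_bigr => i _; rewrite qi.
congr (_ *: _); rewrite mxE ltnn pE !mxE summxE u1 mulr1.
rewrite (eq_bigr (fun i : 'I_(size C) => q 0 (inord i) * C`_i 0 k0)).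
  by rewrite addrC addrK.
by move=> i _; rewrite mxE qi.
Qed.

Lemma in_cone_lift_int p : (forall j, (p *m invmx lift_mx) 0 j != 0) ->
  in_cone lift_mx p -> cone_mod_int [:: u] C p.
Proof.
move=> h0 /forallP h; rewrite -[p](mulmxKV lift_mx_unit) mul_lift_mx; set q := p *m _.
exists (fun i => q 0 (inord i)),
    ((q 0 ord_max - \sum_(i < size C) q 0 (inord i) * C`_i 0 k0) *: u).
  split=> // [i|]; last by rewrite span_seq1 memvZ ?memv_line.
by rewrite lt_neqAle eq_sym h0 h.
Qed.

End Lifts.
End QuotientCones.

(* The lifts are chosen in the hyperplane [w 0 k0 = 0]; together with [u] they span
   cones tiling the half-space [0 <= w 0 k0], and adding this coordinate to [phi]
   gives [u] the value 1. *)
Lemma quotient_valuation (R : realType) (K : fieldType) (f : {rmorphism R -> K})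
    n (u : 'rV[R]_n) (k0 : 'I_n) (I : finType) (a : I -> R)
    (C : I -> seq 'rV[R]_n) (phi : 'rV[R]_n -> K) :
  u 0 k0 = 1 ->
  (forall i, (size (C i)).+1 = n) ->
  (forall i, det_seq (rcons (C i) u) != 0) ->
  (forall i w, w \in C i -> phi w != 0) ->
  (forall i, exists2 L : 'cV[K]_n, map_mx f u *m L = 0 &
    forall p, cone_mod [:: u] (C i) p -> phi p = (map_mx f p *m L) 0 0) ->
  (forall p, (forall i, cone_mod [:: u] (C i) p -> cone_mod_int [:: u] (C i) p) ->
    \sum_(i | `[<cone_mod [:: u] (C i) p>]) a i = 0) ->
  \sum_i f (a i * `|det_seq (rcons (C i) u)|) / \prod_(w <- C i) phi w = 0.
Proof.
case: n u k0 C phi => [u []//|m] u k0 C phi u1 sC dC nphi hL rel.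
have {}sC i : size (C i) = m by have [] := sC i.
pose M i := lift_mx u k0 (C i).
pose psi p := phi p + f (p 0 k0).
have uM i : M i \in unitmx by exact: lift_mx_unit.
have inE i p := in_cone_lift u1 (sC i) (dC i) p.
have psiu (i : I) : psi u = 1.
  have [L uL hi] := hL i; rewrite /psi u1 rmorph1 hi ?uL ?mxE ?add0r //.
  exists (fun=> 0), u; split=> //; first by rewrite memv_span1.
  by rewrite big1 ?add0r // => j _; rewrite scale0r.
have gen_cone i w : w \in C i -> forall b, cone_mod [:: u] (C i) (w + b *: u).
  move=> wC b; exists (fun k => (k == index w (C i))%:R), (b *: u); split.
  - by move=> k; rewrite ler0n.
  - by rewrite memvZ ?memv_span1.
  have iw : (index w (C i) < size (C i))%N by rewrite index_mem.
  rewrite (bigD1 (Ordinal iw)) //= eqxx scale1r nth_index // big1 ?addr0 // => j.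
  by rewrite -val_eqE /= => /negPf ->; rewrite scale0r.
have psiw i w : w \in C i -> psi (normal_lift u k0 w) = phi w.
  move=> wC; have [L uL hi] := hL i.
  rewrite /psi /normal_lift !mxE u1 mulr1 subrr rmorph0 addr0.
  rewrite -scaleNr hi; last exact: gen_cone.
  rewrite map_mxD map_mxZ mulmxDl -scalemxAl uL scaler0 addr0 -hi //.
  by rewrite -[w]addr0 -(scale0r u); exact: gen_cone.
have prodE i : \prod_j psi (row j (M i)) = \prod_(w <- C i) phi w.
  under eq_bigr do rewrite row_seq_mx.
  rewrite big_ord_recr /= nth_rcons size_map sC ltnn eqxx (psiu i) mulr1.
  rewrite (big_nth 0) big_mkord sC; apply: eq_bigr => j _.
  by rewrite nth_rcons size_map sC ltn_ord (nth_map 0) ?sC // (psiw i) ?mem_nth ?sC.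
rewrite -[RHS](@piecewise_valuation _ _ f _ _ a M psi) //.
- by apply: eq_bigr => i _; rewrite prodE det_lift_mx.
- move=> i j; suff /prodf_neq0 h : \prod_j psi (row j (M i)) != 0 by exact: h.
  by rewrite prodE prodf_seq_neq0; apply/allP => w /nphi.
- move=> i; have [L uL hi] := hL i.
  exists (L + delta_mx k0 0) => p /inE[_ pC]; rewrite /psi hi //.
  by rewrite mulmxDr -colE !mxE.
(* No cone reaches outside the half-space; inside it, the nonzero coordinates of [p] turn membership
   into interior membership. *)
- move=> p gp; have [p0|p0] := leP 0 (p 0 k0); last first.
    rewrite big_pred0 // => i; apply/negP => /inE[]; by rewrite leNgt p0.
  rewrite -[RHS](rel p); last first.
    move=> i pC; apply: (in_cone_lift_int (sC i) (dC i)); first exact: gp.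
    by apply/inE.
  by apply: eq_bigl => i; apply/idP/asboolP => [/inE[]//|pC]; apply/inE.
Qed.

(** * Minimizers, normal fans and triangulations *)

Section Minimizers.
Context {R : realType} {n : nat}.
Implicit Types (v w x y : 'rV[R]_n) (Q F : set 'rV[R]_n) (s ls C : seq 'rV[R]_n).

Lemma dotE v y : dot v y = (v *m y^T) 0 0.
Proof. by rewrite mxE; apply: eq_bigr => k _; rewrite mxE. Qed.

Lemma dotZl c v y : dot (c *: v) y = c * dot v y.
Proof. by rewrite !dotE -scalemxAl mxE. Qed.

Lemma dotDr v y y' : dot v (y + y') = dot v y + dot v y'.
Proof. by rewrite !dotE linearD mulmxDr mxE. Qed.

Lemma dotZr c v y : dot v (c *: y) = c * dot v y.
Proof. by rewrite !dotE linearZ -scalemxAr mxE. Qed.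

Lemma dotNr v y : dot v (- y) = - dot v y.
Proof. by rewrite -scaleN1r dotZr mulN1r. Qed.

Lemma dot_suml (I : finType) (g : I -> 'rV[R]_n) y :
  dot (\sum_i g i) y = \sum_i dot (g i) y.
Proof.
rewrite dotE mulmx_suml summxE; by apply: eq_bigr => i _; rewrite dotE.
Qed.

Lemma dot_sumr (I : finType) v (g : I -> 'rV[R]_n) :
  dot v (\sum_i g i) = \sum_i dot v (g i).
Proof.
rewrite dotE linear_sum mulmx_sumr summxE; by apply: eq_bigr => i _; rewrite dotE.
Qed.

Definition minimizer Q v y := Q y /\ forall y', Q y' -> dot v y <= dot v y'.

Lemma minimizer_support Q v y : minimizer Q v y -> Defs.support Q v = - dot v y.
Proof.
move=> [Qy my]; congr (- _); apply/eqP; rewrite eq_le; apply/andP; split.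
  by apply: ge_inf; [exists (dot v y) => _ [y' Qy' <-]; exact: my|exists y].
by apply: lb_le_inf; [exists (dot v y), y|move=> _ [y' Qy' <-]; exact: my].
Qed.

Lemma conv_hull_ge Q v c : (forall y, Q y -> c <= dot v y) ->
  forall y, conv_hull Q y -> c <= dot v y.
Proof.
move=> h; apply: (@smallest_sub _ _ Q [set y | c <= dot v y] _ h) => x x' l.
rewrite !inE /= => hx hx'.
rewrite -[c in c <= _]mul1r -(subrKC l%:num 1) mulrDl.
rewrite [dot _ _](_ : _ = l%:num * dot v x + (1 - l%:num) * dot v x'); last first.
  by rewrite -!dotZr -dotDr.
by rewrite lerD // ler_wpM2l // ?subr_ge0.
Qed.

Lemma polytope_minimizer Q v : is_polytope Q -> exists y, minimizer Q v y.
Proof.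
move=> [s s0 ->].
have [y ys my] : exists2 y, y \in s & forall y', y' \in s -> dot v y <= dot v y'.
  elim: s s0 => // x [_ _|x' s /(_ isT)[y ys my] _].
    by exists x; rewrite ?mem_head // => y'; rewrite inE => /eqP ->.
  have [xy|yx] := leP (dot v x) (dot v y).
    exists x; rewrite ?mem_head // => y'; rewrite inE => /orP[/eqP -> //|/my].
    exact: le_trans.
  exists y => [|y']; first by rewrite in_cons ys orbT.
  by rewrite in_cons => /orP[/eqP -> |/my //]; exact: ltW.
exists y; split; first exact: sub_gen_smallest.
exact: conv_hull_ge.
Qed.

Section Fan.
Variable Q : set 'rV[R]_n.
Hypothesis minQ : forall v, exists y, minimizer Q v y.

Lemma normal_fan_complete v : exists2 S, normal_fan Q S & S v.
Proof.
have [y my] := minQ v.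
pose F := [set y | Q y /\ forall y', Q y' -> dot v y <= dot v y'].
exists (normal_cone Q F); last by move=> y' my'; exact: minimizer_support.
by exists F => //; split; [exists y|exists v].
Qed.

(** Any single point of the face minimizes every form of its normal cone, so the support function is
    linear on that cone. *)
Lemma normal_fan_minimizer S : normal_fan Q S ->
  exists y, forall v, S v -> minimizer Q v y.
Proof.
move=> [F [[y Fy] [v0 FE]] <-]; exists y => v /(_ y Fy) svy.
have [y0 my0] := minQ v; rewrite FE in Fy; split; first by case: Fy.
by move: svy; rewrite (minimizer_support my0) => /oppr_inj <-; case: my0.
Qed.

End Fan.

Lemma sub_cone_mod_int ls s : cone_mod_int ls s `<=` cone_mod ls s.
Proof.
by move=> x [c [l [c0 ls_l xE]]]; exists c, l; split=> // i; exact: ltW.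
Qed.

Lemma mem_cone_mod ls s w : w \in s -> cone_mod ls s w.
Proof.
move=> ws; exists (fun i => (i == index w s)%:R), 0; split.
- by move=> i; exact: ler0n.
- exact: mem0v.
have iw : (index w s < size s)%N by rewrite index_mem.
rewrite addr0 (bigD1 (Ordinal iw)) //= eqxx scale1r nth_index // big1 ?addr0 // => j.
by rewrite -val_eqE /= => /negPf ->; rewrite scale0r.
Qed.

(** From the interior point [x], a small step away from [y'] stays in the cone; minimality at [x]
    then gives [dot v y' <= dot v x], so [y'] lies in the face too. *)
Lemma face_int ls s A x : is_face (cone_mod ls s) (cone_mod ls s `&` A) ->
  cone_mod_int ls s x -> A x -> cone_mod ls s `<=` A.
Proof.
move=> [_ [v FE]] xint Ax y' sy'.
suff : (cone_mod ls s `&` A) y' by case.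
have : (cone_mod ls s `&` A) x by split=> //; exact: sub_cone_mod_int.
rewrite FE => -[_ mx]; split=> // z /mx; apply: le_trans.
have [c [l [c0 ll xE]]] := xint; have [c' [l' [c'0 ll' yE]]] := sy'.
have [e e0 he] := small_perturbation [seq (c i, c i - c' i) | i <- iota 0 (size s)].
have : dot v x <= dot v (x + e *: (x - y')).
  (* The choice of [e] controls only indices below [size s]; the value 0 keeps the other
     coefficients nonnegative. *)
  apply: mx; exists (fun i => if (i < size s)%N then c i + e * (c i - c' i) else 0).
  exists (l + e *: (l - l')); split.
  - move=> i; case: ifP => // si; rewrite addr_small_ge0 ?ltW //.
    apply: (he (c i, c i - c' i)); last by rewrite /= gt_eqF ?c0.
    by apply/mapP; exists i; rewrite ?mem_iota.
  - by rewrite rpredD ?rpredZ ?rpredB.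
  rewrite xE yE opprD addrACA -sumrB scalerDr scaler_sumr addrACA -big_split /=.
  congr (_ + _); apply: eq_bigr => i _.
  by rewrite ltn_ord -scalerBl scalerA scalerDl.
by rewrite dotDr dotZr dotDr dotNr lerDl pmulr_rge0 // subr_ge0.
Qed.

Section Triangulations.
Variables (ls : seq 'rV[R]_n) (Q : set 'rV[R]_n) (T : seq (seq 'rV[R]_n)).
Hypothesis minQ : forall v, exists y, minimizer Q v y.
Hypothesis triT : is_triangulation ls (normal_fan Q) T.

Lemma triangulation_cover p : exists i : 'I_(size T), cone_mod ls (nth [::] T i) p.
Proof.
have [S NS Sp] := normal_fan_complete minQ p.
have [_ _ _ /(_ S p NS Sp)[C CT Cp] _] := triT.
have iC : (index C T < size T)%N by rewrite index_mem.
by exists (Ordinal iC); rewrite nth_index.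
Qed.

Lemma triangulation_minimizer (i : 'I_(size T)) :
  exists y, forall v, cone_mod ls (nth [::] T i) v -> minimizer Q v y.
Proof.
have [_ _ /(_ (nth [::] T i) (mem_nth _ (ltn_ord i)))[S NS CS] _ _] := triT.
have [y hy] := normal_fan_minimizer minQ NS.
by exists y => v /CS /hy.
Qed.

(** A common interior point lies in the intersection, a face of both cones; by [face_int] each cone
    is then contained in the other. *)
Lemma triangulation_int_unique (i j : 'I_(size T)) p :
  cone_mod_int ls (nth [::] T i) p -> cone_mod_int ls (nth [::] T j) p -> i = j.
Proof.
move=> pi pj; apply/eqP; apply: contraT => ij.
have [_ _ _ _ /(_ i j (ltn_ord i) (ltn_ord j) ij)[AB fA fB]] := triT.
case: AB; apply/seteqP; split.
  by apply: face_int fA pi _; exact: sub_cone_mod_int.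
by rewrite setIC in fB; apply: face_int fB pj _; exact: sub_cone_mod_int.
Qed.

End Triangulations.
End Minimizers.

(** * Determinants of generators and linear forms in the indeterminates *)

Section DetSeq.
Context {R : realType} {n : nat}.
Implicit Types (s t C : seq 'rV[R]_n) (u w : 'rV[R]_n).

Lemma det_seq_perm s t : size t = n -> perm_eq s t ->
  `|det_seq s| = `|det_seq t|.
Proof.
move=> st; have [tt ->] : exists tt : n.-tuple 'rV[R]_n, t = tt.
  by exists (tcast st (in_tuple t)); rewrite val_tcast.
move/tuple_permP => [p ->].
rewrite /det_seq (_ : \matrix_(_, _) _ = row_perm p (seq_mx tt)).
  by rewrite row_permE det_mulmx det_perm normrM normr_sign mul1r.
apply/matrixP => i k; rewrite !mxE -(tnth_nth 0 [tuple tnth tt (p i) | i < n]).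
by rewrite tnth_mktuple (tnth_nth 0).
Qed.

Lemma basis_det_seq s : basis_of fullv s -> size s = n /\ det_seq s != 0.
Proof.
move=> bs; have sn : size s = n.
  by rewrite -(@vector.size_basis _ _ _ _ (in_tuple s) bs) dimvf /dim /= mul1n.
split=> //; apply/negP => /det0P[v v0 vs].
case/andP: bs => _; rewrite -[s]/(tval (in_tuple s)) => /freeP fs.
case/eqP: v0; apply/rowP => i; rewrite mxE.
have is' : (i < size s)%N by rewrite sn.
rewrite -(fs (fun j => v 0 (cast_ord sn j)) _ (Ordinal is')).
  by congr (v _ _); exact: val_inj.
rewrite -[RHS]vs -[X in v *m X]/(seq_mx s) mul_seq_mx.
rewrite [RHS](reindex (cast_ord sn)); first by apply: eq_bigr => j _; congr (_ *: _).
by exists (cast_ord (esym sn)) => j _; rewrite ?cast_ordK ?cast_ordKV.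
Qed.

(** Rows of an invertible matrix are independent. This keeps denominators nonzero, as [cayley_form]
    vanishes only at multiples of [u]. *)
Lemma mem_det_seq_rcons C u w c : (size C).+1 = n -> det_seq (rcons C u) != 0 ->
  w \in C -> w != c *: u.
Proof.
move=> sC dC wC; apply/eqP => wE.
have uM : seq_mx (rcons C u) \in unitmx by rewrite unitmxE unitfE.
have iC : (index w C < size C)%N by rewrite index_mem.
have l_n : (size C < n)%N by rewrite -[X in (_ < X)%N]sC.
have i_n : (index w C < n)%N by exact: ltn_trans l_n.
pose i := Ordinal i_n; pose l := Ordinal l_n.
have : row i (seq_mx (rcons C u)) = c *: row l (seq_mx (rcons C u)).
  by rewrite !row_seq_mx !nth_rcons iC ltnn eqxx nth_index.
move/(congr1 (fun A => (A *m invmx (seq_mx (rcons C u))) 0 i)).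
rewrite -scalemxAl -!row_mul mulmxV // !mxE eqxx.
have -> : (l == i) = false by rewrite -val_eqE /= gtn_eqF.
by rewrite mulr0 => /eqP; rewrite oner_eq0.
Qed.

Lemma cone_sum_cat (c : nat -> R) s t :
  \sum_(i < size (s ++ t)) c i *: (s ++ t)`_i =
  \sum_(i < size s) c i *: s`_i + \sum_(i < size t) c (size s + i)%N *: t`_i.
Proof.
rewrite size_cat big_split_ord /=; congr (_ + _); apply: eq_bigr => i _.
  by rewrite nth_cat ltn_ord.
by rewrite nth_cat ltnNge leq_addr /= addKn.
Qed.

End DetSeq.

Section RationalFunctions.
Variables (R : realType) (n : nat).

(** Convertible to [rf_const]; the morphism structure allows extension of scalars for matrices. *)
Definition rf_const_rmorphism : {rmorphism R -> ratfun R n} :=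
  @FracField.tofrac {mpoly R[n]} \o @mpolyC n R.

Lemma rf_linear_eq0 (c : 'rV[R]_n) :
  \sum_k rf_const n (c 0 k) * rf_var R k = 0 -> c = 0.
Proof.
have -> : \sum_k rf_const n (c 0 k) * rf_var R k =
    FracField.tofrac (\sum_k c 0 k *: 'X_k).
  rewrite rmorph_sum; apply: eq_bigr => k _.
  by rewrite -mul_mpolyC rmorphM.
move/eqP; rewrite tofrac_eq0 => /eqP h; apply/rowP => k; rewrite mxE.
have := congr1 (mcoeff U_(k)) h; rewrite mcoeff0 raddf_sum (bigD1 k) //= => <-.
rewrite mcoeffZ mcoeffXU eqxx mulr1 big1 ?addr0 // => j /negPf jk.
by rewrite mcoeffZ mcoeffXU jk mulr0.
Qed.

End RationalFunctions.

(** * The Cayley polytope and its linear forms *)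

Section Cayley.
Context {R : realType} {d r : nat}.
Variable P : 'I_r -> set 'rV[R]_d.
Hypothesis minP : forall i v, exists y, minimizer (P i) v y.

Local Notation u := (@cayley_normal R d r).
Local Notation K := (ratfun R (d + r)).
Local Notation const := (@rf_const R (d + r)).
Local Notation f := (rf_const_rmorphism R (d + r)).

Lemma dot_row_mx (v y : 'rV[R]_d) (a b : 'rV[R]_r) :
  dot (row_mx v a) (row_mx y b) = dot v y + dot a b.
Proof. by rewrite !dotE tr_row_mx mul_row_col mxE. Qed.

Lemma dot_delta (a : 'rV[R]_r) i : dot a (delta_mx 0 i) = a 0 i.
Proof. by rewrite dotE trmx_delta -colE mxE. Qed.

Lemma dot_vertex (p : 'rV[R]_(d + r)) (y : 'rV[R]_d) i :
  dot p (row_mx y (delta_mx 0 i)) = dot (lsubmx p) y + rsubmx p 0 i.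
Proof. by rewrite -{1}[p]hsubmxK dot_row_mx dot_delta. Qed.

Lemma cayley_minimizer (p : 'rV[R]_(d + r)) i y : P i y ->
  (forall j y', P j y' ->
    dot (lsubmx p) y + rsubmx p 0 i <= dot (lsubmx p) y' + rsubmx p 0 j) ->
  minimizer (cayley P) p (row_mx y (delta_mx 0 i)).
Proof.
move=> Py h; split; first by apply: sub_gen_smallest; exists i => //; exists y.
by apply: conv_hull_ge => _ [j _ [y' Py' <-]]; rewrite !dot_vertex; exact: h.
Qed.

Lemma cayley_minimizer_ex (p : 'rV[R]_(d + r)) : (0 < r)%N ->
  exists y, minimizer (cayley P) p y.
Proof.
move=> r0; have /fin_all_exists[g hg] := minP^~ (lsubmx p).
pose val j := dot (lsubmx p) (g j) + rsubmx p 0 j.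
have [i _ hi] : exists2 i, i \in 'I_r & forall j, val i <= val j.
  by case: (arg_minP val (erefl : xpredT (Ordinal r0))) => i _ h; exists i => // j; exact: h.
exists (row_mx (g i) (delta_mx 0 i)); apply: cayley_minimizer; first by case: (hg i).
move=> j y' Py'; apply: le_trans (hi j) _; rewrite lerD2r.
by case: (hg j) => _; apply.
Qed.

Lemma minkowski_minimizer_ex v : exists y, minimizer (minkowski_sum P) v y.
Proof.
have /fin_all_exists[g hg] := minP^~ v.
exists (\sum_i g i); split; first by exists g => // i; case: (hg i).
move=> _ [g' Pg' ->]; rewrite !dot_sumr ler_sum // => i _.
by case: (hg i) => _; apply.
Qed.

(** Exchanging the [i]-th summand for another point of [P i] stays in the Minkowski sum and changes
    one term only. *)
Lemma minkowski_minimizer (v : 'rV[R]_d) g : (forall i, P i (g i)) ->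
  minimizer (minkowski_sum P) v (\sum_i g i) -> forall i, minimizer (P i) v (g i).
Proof.
move=> Pg [_ mg] i; split=> // y Py.
pose g' j := if j == i then y else g j.
have : dot v (\sum_j g j) <= dot v (\sum_j g' j).
  by apply: mg; exists g' => // j; rewrite /g'; case: eqP => [->|].
rewrite !dot_sumr (bigD1 i) //= [X in _ <= X](bigD1 i) //= /g' eqxx.
rewrite [X in _ <= _ + X](eq_bigr (fun j => dot v (g j))) ?lerD2r //.
by move=> j /negPf ->.
Qed.

Lemma cayley_height y : cayley P y -> dot u y = 1.
Proof.
move=> Cy.
(* The cases 1 and -1 of [c] bound the height from both sides. *)
have h c : c <= dot (c *: u) y.
  apply: (conv_hull_ge _ Cy) => _ [i _ [y' _ <-]].
  by rewrite dotZl dot_row_mx dot_delta mxE dotE mul0mx mxE add0r mulr1.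
by have := h 1; have := h (-1); rewrite !dotZl; lra.
Qed.

(** The denominator factor of the dual volume; as a function of [p] it is the [phi] of
    [quotient_valuation]. *)
Definition cayley_form (p : 'rV[R]_(d + r)) : K :=
  (\sum_(i < r) xvar i) * const (Defs.support (cayley P) p) +
  \sum_(k < d + r) const (p 0 k) * rf_var R k.

Lemma sum_xvarE :
  \sum_(i < r) xvar i = \sum_(k < d + r) const (u 0 k) * rf_var R k :> K.
Proof.
rewrite [RHS]big_split_ord /= [X in _ = X + _]big1 ?add0r => [|i _].
  by apply: eq_bigr => i _; rewrite row_mxEr mxE [const 1](rmorph1 f) mul1r.
by rewrite row_mxEl mxE [const 0](rmorph0 f) mul0r.
Qed.

(** With [t] the sum of the [xvar i], [L] is the vector of indeterminates minus [t] times [y]. It is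
    killed by [u] because [u] pairs to [t] with the indeterminates and to 1 with [y]. *)
Lemma cayley_form_linear y : cayley P y ->
  exists2 L : 'cV[K]_(d + r), map_mx f u *m L = 0 &
    forall p, minimizer (cayley P) p y -> cayley_form p = (map_mx f p *m L) 0 0.
Proof.
move=> Cy; pose L : 'cV[K]_(d + r) := \col_k
  (rf_var R k - (\sum_(i < r) xvar i) * const (y 0 k)).
have LE p : (map_mx f p *m L) 0 0 = \sum_(k < d + r) const (p 0 k) * rf_var R k -
    (\sum_(i < r) xvar i) * const (dot p y).
  rewrite mxE [const (dot p y)](rmorph_sum f) mulr_sumr -sumrB.
  apply: eq_bigr => k _; rewrite !mxE rmorphM /= mulrBr; congr (_ - _).
  by rewrite mulrCA.
exists L => [|p my].
  apply/matrixP => i j; rewrite (ord1 i) (ord1 j) LE cayley_height //.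
  by rewrite [const 1](rmorph1 f) mulr1 sum_xvarE subrr mxE.
by rewrite LE /cayley_form (minimizer_support my) [const (- _)](rmorphN f) mulrN addrC.
Qed.

(** By [sum_xvarE] the form pairs [p + h *: u] with the indeterminates, which are linearly
    independent over [R]. *)
Lemma cayley_form_eq0 p :
  cayley_form p = 0 -> p = - Defs.support (cayley P) p *: u.
Proof.
rewrite /cayley_form sum_xvarE mulr_suml -big_split /=; set h := Defs.support _ _.
move=> e; apply/eqP; rewrite scaleNr -addr_eq0; apply/eqP/rf_linear_eq0.
rewrite -[RHS]e; apply: eq_bigr => k _.
rewrite [fun_of_matrix (_ + _) _ _]mxE [fun_of_matrix (_ *: _) _ _]mxE.
rewrite [const (_ + _)](rmorphD f) [f (_ * _)]rmorphM mulrDl addrC.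
by congr (_ + _); rewrite -mulrA mulrC.
Qed.

End Cayley.

(** * Lifts of the cones of the Minkowski fan *)

Section LiftedCones.
Context {R : realType} {d r : nat}.
Variable P : 'I_r -> set 'rV[R]_d.

Local Notation u := (@cayley_normal R d r).
Local Notation const := (@rf_const R (d + r)).
Local Notation f := (rf_const_rmorphism R (d + r)).

(** The point over [v] at which every [excess] vanishes. *)
Definition lift_row (v : 'rV[R]_d) : 'rV[R]_(d + r) :=
  row_mx v (\row_k Defs.support (P k) v).

Definition lift_cone (C : seq 'rV[R]_d) (j : 'I_r) : seq 'rV[R]_(d + r) :=
  [seq lift_row v | v <- C] ++
  [seq row_mx 0 (delta_mx 0 k) | k <- enum (predC1 j)].

(* The support function of the Cayley polytope at p is the maximum of these. *)
Definition excess (p : 'rV[R]_(d + r)) (k : 'I_r) : R :=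
  Defs.support (P k) (lsubmx p) - rsubmx p 0 k.

Section OneCone.
Variables (C : seq 'rV[R]_d) (g : 'I_r -> 'rV[R]_d) (j : 'I_r).
Hypothesis gP : forall v, cone_mod [::] C v -> forall k, minimizer (P k) v (g k).

Let supportE v k : cone_mod [::] C v -> Defs.support (P k) v = - dot v (g k).
Proof. by move=> Cv; exact/minimizer_support/gP. Qed.

(** Position in [lift_cone C j] of the standard vector of index [k], for [k != j]. *)
Let slot (k : 'I_r) := (size C + index k (enum (predC1 j)))%N.

(** Each support function is linear on the cone of [C], so the lifted rows leave every excess at 0.
    Adding [u] lowers all excesses equally, and a standard vector lowers only its own. *)
Lemma lift_cone_sum (c : nat -> R) b : (forall i, 0 <= c i) ->
  let p := \sum_(i < size (lift_cone C j)) c i *: (lift_cone C j)`_i + b *: u in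
  lsubmx p = \sum_(i < size C) c i *: C`_i /\
  forall k, excess p k = - b - (if k == j then 0 else c (slot k)).
Proof.
move=> c0; rewrite cone_sum_cat !size_map.
set s1 := \sum_(i < size C) _; set s2 := \sum_(i < size (enum _)) _.
have s1E : s1 = row_mx (\sum_(i < size C) c i *: C`_i)
    (\sum_(i < size C) c i *: \row_k Defs.support (P k) C`_i).
  apply: (big_rec3 (fun x y z => z = row_mx x y)) => [|i x y z _ ->].
    by rewrite row_mx0.
  by rewrite (nth_map 0) // scale_row_mx add_row_mx.
have s2E : s2 = row_mx 0 (\row_k (if k == j then 0 else c (slot k))).
  transitivity (\sum_(k <- enum (predC1 j))
      c (slot k) *: row_mx (0 : 'rV[R]_d) (delta_mx 0 k : 'rV[R]_r)).
    rewrite (big_nth j) big_mkord; apply: eq_bigr => i _.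
    by rewrite (nth_map j) // /slot index_uniq ?enum_uniq.
  rewrite big_enum /= [X in row_mx 0 X]row_sum_delta.
  rewrite [in RHS](bigID (predC1 j)) /= [X in _ + X]big1 ?addr0; last first.
    by move=> k /negPn kj; rewrite mxE kj scale0r.
  apply: (big_rec2 (fun x z => x = row_mx 0 z)) => [|k x z /negPf kj ->].
    by rewrite row_mx0.
  by rewrite scale_row_mx add_row_mx scaler0 addr0 mxE kj.
move=> p.
have pE : p = row_mx (\sum_(i < size C) c i *: C`_i)
  (\sum_(i < size C) c i *: \row_k Defs.support (P k) C`_i +
   \row_k (if k == j then 0 else c (slot k)) + b *: const_mx 1).
  by rewrite /p s1E s2E /u /cayley_normal scale_row_mx !add_row_mx scaler0 !addr0.
have lE : lsubmx p = \sum_(i < size C) c i *: C`_i by rewrite pE row_mxKl.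
split=> // k; rewrite /excess lE pE row_mxKr supportE; last first.
  by exists c, 0; rewrite addr0 mem0v.
rewrite !mxE mulr1 dot_suml summxE.
have -> : \sum_(i < size C) (c i *: \row_k0 Defs.support (P k0) C`_i) 0 k =
    - \sum_(i < size C) dot (c i *: C`_i) (g k).
  rewrite -sumrN; apply: eq_bigr => i _; rewrite !mxE supportE ?mulrN ?dotZl //.
  by apply: mem_cone_mod; rewrite mem_nth.
by ring.
Qed.

(** The standard vectors have the gaps [excess p j - excess p k] as coefficients, and [u] has
    [- excess p j]; nonnegativity of the gaps is maximality of [excess p j]. *)
Lemma lift_cone_mod p : cone_mod [:: u] (lift_cone C j) p <->
  cone_mod [::] C (lsubmx p) /\ forall k, excess p k <= excess p j.
Proof.
split=> [[c [l [c0 /[!span_seq1]/vlineP[b ->] ->]]]|].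
  have [-> h] := lift_cone_sum b c0; split=> [|k]; last first.
    by rewrite !h eqxx lerD2l lerN2; case: ifP.
  by exists c, 0; rewrite addr0 mem0v.
move=> [[c [l [c0 /[!span_nil]/[!memv0]/eqP -> lE]]] hp].
pose c' i := if (i < size C)%N then c i
  else excess p j - excess p (nth j (enum (predC1 j)) (i - size C)).
have c'0 i : 0 <= c' i by rewrite /c'; case: ifP => // _; rewrite subr_ge0.
have [] := lift_cone_sum (- excess p j) c'0; set q := _ + _ => qE h.
exists c', (- excess p j *: u); split=> //; first by rewrite span_seq1 memvZ ?memv_line.
have lpq : lsubmx p = lsubmx q.
  by rewrite lE qE addr0; apply: eq_bigr => i _; rewrite /c' ltn_ord.
(* A point is determined by its first part and its excesses. *)
rewrite -[LHS]hsubmxK -[RHS]hsubmxK -/q lpq; congr row_mx; apply/rowP => k.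
have : excess p k = excess q k.
  rewrite h opprK; case: eqP => [->|/eqP kj]; first by rewrite subr0.
  rewrite /c' /slot ltnNge leq_addr /= addKn nth_index ?mem_enum ?inE //.
  by rewrite opprB addrC subrK.
by rewrite /excess lpq => /addrI/oppr_inj.
Qed.

(** Positive coefficients make the gaps strict, so the index [j] is determined by an interior
    point. *)
Lemma lift_cone_mod_int p : cone_mod_int [:: u] (lift_cone C j) p ->
  cone_mod_int [::] C (lsubmx p) /\ forall k, k != j -> excess p k < excess p j.
Proof.
move=> [c [l [c0 /[!span_seq1]/vlineP[b ->] ->]]].
have [|-> h] := @lift_cone_sum c b; first by move=> i; exact: ltW.
split=> [|k kj]; last by rewrite !h eqxx (negPf kj) ltrD2l ltrN2.
by exists c, 0; rewrite addr0 mem0v.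
Qed.

Lemma lift_cone_minimizer p : cone_mod [:: u] (lift_cone C j) p ->
  minimizer (cayley P) p (row_mx (g j) (delta_mx 0 j)).
Proof.
move=> /lift_cone_mod[Cp hp]; apply: cayley_minimizer; first by case: (gP Cp j).
move=> k y Py; have := hp k; rewrite /excess !supportE // => h.
by case: (gP Cp k) => _ /(_ y Py); lra.
Qed.

Lemma size_lift_cone : size C = d -> (size (lift_cone C j)).+1 = (d + r)%N.
Proof.
move=> sC; rewrite size_cat !size_map sC -cardE cardC1 card_ord -addnS.
by case: r j => [[]|].
Qed.

(** With [u] moved to the missing [j]-th place, the matrix is block triangular with diagonal blocks
    [seq_mx C] and [E], the identity with row [j] replaced by ones. *)
Lemma det_lift_cone : size C = d ->
  `|det_seq (rcons (lift_cone C j) u)| = `|det_seq C|.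
Proof.
move=> sC.
pose e k : 'rV[R]_r := if k == j then const_mx 1 else delta_mx 0 k.
pose s := [seq lift_row v | v <- C] ++ [seq row_mx 0 (e k) | k <- enum 'I_r].
have ss : size s = (d + r)%N by rewrite size_cat 2!size_map sC size_enum_ord.
rewrite (@det_seq_perm _ _ _ s) //; last first.
  rewrite /lift_cone rcons_cat perm_cat2l perm_rcons.
  have -> : u :: [seq row_mx 0 (delta_mx 0 k) | k <- enum (predC1 j)] =
      [seq row_mx 0 (e k) | k <- j :: enum (predC1 j)].
    rewrite /= /e eqxx; congr cons; apply/eq_in_map => k.
    by rewrite mem_enum inE => /negPf ->.
  apply: perm_map; apply: uniq_perm; rewrite /= ?enum_uniq ?mem_enum ?inE ?eqxx //.
  by move=> k; rewrite inE !mem_enum !inE; case: eqP.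
pose E : 'M[R]_r := \matrix_(k, l) e k 0 l.
have -> : det_seq s = \det (block_mx (seq_mx C)
    (\matrix_(i, k) Defs.support (P k) C`_i) 0 E).
  congr (\det _); apply/matrixP => i l; rewrite mxE /s nth_cat size_map sC.
  have [i' ->|i' ->] := split_ordP i.
    have i'C : (lshift r i' < size C)%N by rewrite sC; exact: (ltn_ord i').
    rewrite (nth_map 0) // /lift_row.
    have [l' ->|l' ->] := split_ordP l.
      by rewrite block_mxEul row_mxEl mxE.
    by rewrite block_mxEur row_mxEr !mxE.
    have -> : (rshift d i' - d = i')%N by exact: addKn.
  rewrite (nth_map j) ?size_enum_ord // nth_ord_enum.
  have [l' ->|l' ->] := split_ordP l.
    by rewrite block_mxEdl row_mxEl !mxE.
  by rewrite block_mxEdr row_mxEr !mxE.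
rewrite det_ublock normrM.
suff -> : \det E = 1 by rewrite normr1 mulr1.
(* Only row [j] has a nonzero entry in column [j]. *)
rewrite (expand_det_col _ j) (bigD1 j) //= big1 ?addr0 => [|k /negPf kj].
  rewrite mxE /e eqxx mxE mul1r /cofactor -signr_odd addnn odd_double expr0 mul1r.
  rewrite (_ : row' _ _ = 1%:M) ?det1 //; apply/matrixP => a b.
  rewrite !mxE /e [lift j a == j]eq_sym (negPf (neq_lift _ _)) !mxE /=.
  by rewrite (inj_eq lift_inj) eq_sym.
by rewrite mxE /e kj mxE eq_sym kj mul0r.
Qed.

(** On the lifted cone the support function is the [j]-th excess, which vanishes on lifted rows and
    on standard vectors of index other than [j]. *)
Lemma cayley_support_generator w : w \in lift_cone C j ->
  Defs.support (cayley P) w = 0.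
Proof.
move=> wD.
rewrite (minimizer_support (lift_cone_minimizer (mem_cone_mod [:: u] wD))) dot_vertex.
move: wD; rewrite mem_cat => /orP[/mapP[v vC ->]|/mapP[k]].
  by rewrite row_mxKl row_mxKr mxE supportE ?subrr ?oppr0 //; exact: mem_cone_mod.
rewrite mem_enum inE => /negPf kj ->.
by rewrite row_mxKl row_mxKr mxE eq_sym kj andbF dotE mul0mx mxE addr0 oppr0.
Qed.

Lemma cayley_form_lift_row v : v \in C -> cayley_form P (lift_row v) =
  \sum_(i < r) xvar i * const (Defs.support (P i) v) +
  \sum_(k < d) const (v 0 k) * zvar k.
Proof.
move=> vC; rewrite /cayley_form cayley_support_generator; last first.
  by rewrite mem_cat; apply/orP; left; exact: map_f.
rewrite [const 0](rmorph0 f) mulr0 add0r big_split_ord addrC /=.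
by congr (_ + _); apply: eq_bigr => i _; rewrite ?row_mxEl // row_mxEr mxE mulrC.
Qed.

Lemma cayley_form_delta k : k != j ->
  cayley_form P (row_mx 0 (delta_mx 0 k)) = xvar k.
Proof.
move=> kj; rewrite /cayley_form cayley_support_generator; last first.
  by rewrite mem_cat; apply/orP; right; apply: map_f; rewrite mem_enum.
rewrite [const 0](rmorph0 f) mulr0 add0r big_split_ord /= big1 ?add0r => [|i _].
  rewrite (bigD1 k) //= big1 ?addr0 => [|i /negPf ik].
    by rewrite row_mxEr mxE !eqxx [const _](rmorph1 f) mul1r.
  by rewrite row_mxEr mxE ik andbF [const _](rmorph0 f) mul0r.
by rewrite row_mxEl mxE [const _](rmorph0 f) mul0r.
Qed.

(** Together with [det_lift_cone], this makes the term of a lifted cone that of [C] in the dual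
    mixed volume divided by [\prod_(k | k != j) xvar k]. *)
Lemma prod_cayley_form : \prod_(w <- lift_cone C j) cayley_form P w =
  (\prod_(v <- C) (\sum_(i < r) xvar i * const (Defs.support (P i) v) +
                   \sum_(k < d) const (v 0 k) * zvar k)) *
  \prod_(k | k != j) xvar k.
Proof.
rewrite big_cat !big_map /= big_enum /=; congr (_ * _).
  by rewrite !big_seq; apply: eq_bigr => v; exact: cayley_form_lift_row.
by apply: eq_bigr => k; exact: cayley_form_delta.
Qed.

End OneCone.

End LiftedCones.

(** One point of the Minkowski sum minimizes all forms of a cone; its summands then minimize
    separately. *)
Lemma triangulation_summands {R : realType} {d r : nat}
    (P : 'I_r -> set 'rV[R]_d) (T : seq (seq 'rV[R]_d)) :
  (forall i v, exists y, minimizer (P i) v y) ->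
  is_triangulation [::] (normal_fan (minkowski_sum P)) T ->
  forall i : 'I_(size T), exists g : 'I_r -> 'rV[R]_d,
    forall v, cone_mod [::] (nth [::] T i) v -> forall k, minimizer (P k) v (g k).
Proof.
move=> minP triT i.
have [y hy] := triangulation_minimizer (minkowski_minimizer_ex minP) triT i.
(* The origin lies in every cone, which shows that [y] belongs to the sum. *)
have [|[g Pg yE] _] := hy 0.
  exists (fun=> 0), 0; split=> //; first exact: mem0v.
  by rewrite big1 ?addr0 // => k _; rewrite scale0r.
exists g => v /hy; rewrite yE; exact: minkowski_minimizer.
Qed.

(** * Comparison of the two decompositions *)

Lemma xvar_neq0 (R : realType) d r (i : 'I_r) : xvar i != 0 :> ratfun R (d + r).
Proof.
rewrite /xvar /rf_var tofrac_eq0; apply/eqP => /(congr1 (mcoeff U_(rshift d i))).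
by rewrite mcoeffXU eqxx mcoeff0 => /eqP; rewrite oner_eq0.
Qed.

Lemma sum_xvar_neq0 (R : realType) d r : (0 < r)%N ->
  \sum_(i < r) xvar i != 0 :> ratfun R (d + r).
Proof.
move=> r0; apply/eqP; rewrite sum_xvarE => /rf_linear_eq0.
move/rowP => /(_ (rshift d (Ordinal r0))); rewrite row_mxEr !mxE => /eqP.
by rewrite oner_eq0.
Qed.

Theorem theorem10p3 (R : realType) (d r : nat) (P : 'I_r -> set 'rV[R]_d)
    (T : seq (seq 'rV[R]_d)) (T' : seq (seq 'rV[R]_(d + r))) :
  (0 < r)%N ->
  (forall i, is_polytope (P i)) ->
  full_dimensional (minkowski_sum P) ->
  is_triangulation [::] (normal_fan (minkowski_sum P)) T ->
  is_triangulation [:: cayley_normal] (normal_fan (cayley P)) T' ->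
  let t : ratfun R (d + r) := \sum_(i < r) xvar i in
  dual_mixed_volume P T =
    (\prod_(i < r) xvar i) / (\sum_(i < r) xvar i) *
    dual_volume_hyperplane cayley_normal t (cayley P) T'.
Proof.
move=> r0 polyP _ triT triT' t.
pose u := @cayley_normal R d r.
pose f := rf_const_rmorphism R (d + r).
have minP i v := polytope_minimizer v (polyP i).
have minS := minkowski_minimizer_ex minP.
have minC p := cayley_minimizer_ex minP p r0.
have /fin_all_exists[g hg] := triangulation_summands minP triT.
pose C i := nth [::] T i; pose C' i := nth [::] T' i.
have bT (i : 'I_(size T)) : size (C i) = d /\ det_seq (C i) != 0.
  have [/(_ (C i) (mem_nth _ (ltn_ord i))) + _ _ _ _] := triT.
  by rewrite cats0; exact: basis_det_seq.
have bT' (i : 'I_(size T')) :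
    (size (C' i)).+1 = (d + r)%N /\ det_seq (rcons (C' i) u) != 0.
  have [/(_ (C' i) (mem_nth _ (ltn_ord i))) + _ _ _ _] := triT'.
  by rewrite cats1 => /basis_det_seq; rewrite size_rcons.
(* Both decompositions in one family: cones of [T'] get weight 1, lifted cones weight -1. *)
pose D (x : 'I_(size T') + 'I_(size T) * 'I_r) :=
  match x with inl i => C' i | inr ij => lift_cone P (C ij.1) ij.2 end.
pose a (x : 'I_(size T') + 'I_(size T) * 'I_r) : R :=
  match x with inl _ => 1 | inr _ => -1 end.
have bD x : (size (D x)).+1 = (d + r)%N /\ det_seq (rcons (D x) u) != 0.
  case: x => [i|[i j]] /=; first exact: bT'.
  have [sC dC] := bT i; split; first exact: size_lift_cone.
  by rewrite -normr_eq0 det_lift_cone // normr_eq0.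
have key : \sum_x f (a x * `|det_seq (rcons (D x) u)|) /
    \prod_(w <- D x) cayley_form P w = 0.
  apply: (@quotient_valuation _ _ f _ u (rshift d (Ordinal r0))).
  - by rewrite row_mxEr mxE.
  - by move=> x; case: (bD x).
  - by move=> x; case: (bD x).
  - move=> x w wD; apply/eqP => /cayley_form_eq0 /eqP; apply/negP.
    by have [sD dD] := bD x; exact: (mem_det_seq_rcons _ sD dD).
  - case=> [i|[i j]] /=.
      have [y hy] := triangulation_minimizer minC triT' i.
      have [|Cy _] := hy 0.
        exists (fun=> 0), 0; split=> //; first exact: mem0v.
        by rewrite big1 ?addr0 // => k _; rewrite scale0r.
      by have [L uL hL] := cayley_form_linear Cy; exists L => // p /hy /hL.
    have hm := lift_cone_minimizer (j := j) (hg i).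
    have [|Cy _] := hm 0.
      exists (fun=> 0), 0; split=> //; first exact: mem0v.
      by rewrite big1 ?addr0 // => k _; rewrite scale0r.
    by have [L uL hL] := cayley_form_linear Cy; exists L => // p /hm /hL.
  (* Here [p] is interior to every cone containing it, hence lies in one cone of [T'] and one lifted
     cone, and the weights cancel. *)
  - move=> p intp; rewrite big_sumType /=.
    have [i1 pi1] := triangulation_cover minC triT' p.
    have [i2 pi2] := triangulation_cover minS triT (lsubmx p).
    have [j2 pj2] : exists j2, forall k, excess P p k <= excess P p j2.
      case: (arg_maxP (excess P p) (erefl : xpredT (Ordinal r0))) => j _ h.
      by exists j => k; exact: h.
    have p2 : cone_mod [:: u] (D (inr (i2, j2))) p by apply/(lift_cone_mod j2 (hg i2)).
    rewrite (big_pred1 i1) => [|i /=]; last first.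
      apply/asboolP/eqP => [pi|-> //].
      exact: (triangulation_int_unique triT' (intp (inl i) pi) (intp (inl i1) pi1)).
    rewrite (big_pred1 (i2, j2)) ?subrr // => -[i j] /=.
    apply/asboolP/eqP => [pij|[-> ->] //].
    (* Interiors determine the cone of [T] under [p], and strict maximality of the excess determines
       [j]. *)
    have [ci ej] := lift_cone_mod_int (hg i) (intp (inr (i, j)) pij).
    have [ci2 ej2] := lift_cone_mod_int (hg i2) (intp (inr (i2, j2)) p2).
    rewrite (triangulation_int_unique triT ci ci2); congr pair; apply/eqP.
    apply: contraT => jj2; have := ej j2; rewrite eq_sym => /(_ jj2).
    by rewrite ltNge pj2.
rewrite big_sumType in key.
have volE : dual_volume_hyperplane u t (cayley P) T' =
    \sum_(i < size T') f (1 * `|det_seq (rcons (C' i) u)|) /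
      \prod_(w <- C' i) cayley_form P w.
  rewrite /dual_volume_hyperplane (big_nth [::]) big_mkord.
  by apply: eq_bigr => i _; rewrite mul1r.
have x0 : \prod_(i < r) xvar i != 0 :> ratfun R (d + r).
  by apply/prodf_neq0 => i _; exact: xvar_neq0.
(* The inverse of [\prod_(k | k != j) xvar k] is [xvar j / \prod_k xvar k]; summing over [j] gives
   [t / \prod_k xvar k]. *)
have mixE : \sum_(ij : 'I_(size T) * 'I_r)
      f (-1 * `|det_seq (rcons (lift_cone P (C ij.1) ij.2) u)|) /
      \prod_(w <- lift_cone P (C ij.1) ij.2) cayley_form P w =
    - (dual_mixed_volume P T * (t / \prod_(i < r) xvar i)).
  rewrite /dual_mixed_volume (big_nth [::]) big_mkord.
  rewrite -(pair_bigA _ (fun (i : 'I_(size T)) (j : 'I_r) =>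
      f (-1 * `|det_seq (rcons (lift_cone P (C i) j) u)|) /
      \prod_(w <- lift_cone P (C i) j) cayley_form P w)) /=.
  rewrite mulr_suml -sumrN; apply: eq_bigr => i _.
  rewrite /t mulr_suml mulr_sumr -sumrN; apply: eq_bigr => j _.
  rewrite det_lift_cone; last by case: (bT i).
  rewrite (prod_cayley_form j (hg i)) mulN1r !rmorphN mulNr invfM; congr (- _).
  rewrite [LHS]mulrA; congr (_ * _).
  have -> : \prod_(k < r) xvar k = xvar j * \prod_(k | k != j) xvar k :> ratfun R (d + r).
    by rewrite (bigD1 j).
  by rewrite invfM mulrA mulfV ?xvar_neq0 // mul1r.
have /subr0_eq -> : dual_volume_hyperplane u t (cayley P) T' -
    dual_mixed_volume P T * (t / \prod_(i < r) xvar i) = 0.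
  by rewrite volE -mixE -[RHS]key.
have t0 : t != 0 by exact: sum_xvar_neq0.
by rewrite mulrCA -[_ / _ * _]mulrA mulKf // mulfV // mulr1.
Qed.
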